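(* Let $n \ge 2$ be an integer and let $\mathbf{p}=(p_1,\ldots,p_n)\in[0,1]^n$ with the probabilities sorted in increasing value, $0 \le p_1 \le p_2 \le \cdots \le p_n \le 1$. Then $$\overline{P}(n,1,\mathbf{p}) = \min\left(\sum_{i=1}^{n} p_i - p_n\left(\sum_{i=1}^{n-1} p_i\right),\; 1\right).$$
   Context: Write $[n]=\{1,\ldots,n\}$ and $K_n=\{(i,j): 1\le i<j\le n\}$. Let $\Theta(\{0,1\}^n)$ be the set of all probability distributions on $\{0,1\}^n$; for $\theta$ in this set, $\tilde{\mathbf{c}}=(\tilde c_1,\ldots,\tilde c_n)$ denotes a random vector with law $\theta$. For $\mathbf{p}\in[0,1]^n$ let $$\Theta(\mathbf{p},p_ip_j;(i,j)\in K_n)=\{\theta\in\Theta(\{0,1\}^n): \mathbb{P}_\theta(\tilde c_i=1)=p_i\ \forall i\in[n],\ \mathbb{P}_\theta(\tilde c_i=1,\tilde c_j=1)=p_ip_j\ \forall (i,j)\in K_n\},$$ the set of joint laws of pairwise independent Bernoulli random variables with marginals $\mathbf{p}$. For an integer $k\in[n]$, $$\overline{P}(n,k,\mathbf{p})=\max_{\theta\in\Theta(\mathbf{p},p_ip_j;(i,j)\in K_n)}\mathbb{P}_\theta\left(\sum_{i\in[n]}\tilde c_i\ge k\right).$$ *)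

(* Defs.v *)
From mathcomp Require Import all_boot all_order all_algebra.
From mathcomp Require Import classical_sets reals.

Set Implicit Arguments.
Unset Strict Implicit.
Unset Printing Implicit Defensive.

Import Order.TTheory GRing.Theory Num.Theory.
Local Open Scope classical_set_scope.
Local Open Scope ring_scope.

(* Coordinates are 0-based: index i : 'I_n stands for the element i + 1 of
   {1, ..., n}; true and false stand for 1 and 0. *)
Definition cube (n : nat) := {ffun 'I_n -> bool}.

(* A law on {0,1}^n is given by its probability mass function. *)
Definition laws (R : realType) (n : nat) : set {ffun cube n -> R} :=
  [set theta | (forall c, 0 <= theta c) /\ \sum_(c : cube n) theta c = 1].

Definition Prob (R : realType) (n : nat) (theta : {ffun cube n -> R})
    (A : {pred cube n}) : R :=
  \sum_(c in A) theta c.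

Definition pairwise_indep_laws (R : realType) (n : nat) (p : 'I_n -> R) :
    set {ffun cube n -> R} :=
  [set theta | [/\ @laws R n theta,
    forall i : 'I_n, Prob theta [pred c : cube n | c i] = p i &
    forall i j : 'I_n, (i < j)%N ->
      Prob theta [pred c : cube n | c i && c j] = p i * p j]].

Definition tail_probs (R : realType) (n k : nat) (p : 'I_n -> R) : set R :=
  [set Prob theta [pred c : cube n | (k <= \sum_(i < n) c i)%N]
  | theta in pairwise_indep_laws p].

(* is_Pbar k p v reads "the maximum of the tail probabilities exists and
   equals v"; attainment is part of the claim. *)
Definition is_Pbar (R : realType) (n k : nat) (p : 'I_n -> R) (v : R) : Prop :=
  tail_probs k p v /\ ubound (tail_probs k p) v.

Lemma last_ord_subproof (n : nat) (hn : (2 <= n)%N) : (n.-1 < n)%N.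
Proof. by case: n hn. Qed.

Definition last_ord (n : nat) (hn : (2 <= n)%N) : 'I_n :=
  Ordinal (last_ord_subproof hn).

(* Main.v *)
Require Import Defs.
From mathcomp Require Import all_boot all_order all_algebra.
From mathcomp Require Import classical_sets reals.
From mathcomp Require Import ring lra.

Set Implicit Arguments.
Unset Strict Implicit.
Unset Printing Implicit Defensive.

Import Order.TTheory GRing.Theory Num.Theory.
Local Open Scope ring_scope.

(** Let [m] be the index of the largest probability and let [S] be the sum of
    the other ones; the claimed value is [min (p m + (1 - p m) S) 1].

    Upper bound: pointwise, the indicator of the union is at most
    [sum_i c_i - sum_(i != m) c_i c_m]; take expectations
    ([Prob_union_le]).

    Attainment: all laws used are mixtures of product laws, so that marginals,
    pair probabilities and the probability of the zero vector are sums over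
    the mixture index of products of parameters.  If [S <= 1], mix
    - the point masses at the unit vectors [e_j], with weights
      [(1 - p m) p_j],
    - the point mass at 0, with weight [(1 - p m) (1 - S)],
    - the product law with parameters [p_i / p m], with weight [(p m)^2].
    Only the last component charges a pair [i != j], with total mass
    [p_i p_j], and the marginals are [(1 - p m) p_i + p m p_i = p_i].  If
    [p m != 0], the last component has [c_m = 1] surely, and otherwise its
    weight is 0; so the zero vector has mass [(1 - p m) (1 - S)]
    ([star_mixtureP], [star_mixture_zeros]).
    If [S > 1], apply this to the probabilities [p_i / S], for [i != m], and
    [p m]: the zero vector then has mass 0.  Replacing each [c_i] by its
    disjunction with an independent bit keeps pairwise independence, can only
    enlarge the union, and brings the marginals back up to [p]
    ([or_mixtureP], [or_mixture_zeros]). *)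

(** * Product laws and their mixtures *)

(** The mass at [c] of the product of Bernoulli laws with parameters [a]. *)
Definition product_mass (R : realType) (n : nat) (a : 'I_n -> R)
    (c : cube n) : R :=
  \prod_(i < n) (if c i then a i else 1 - a i).

(** The mixture, with weights [w], of the product laws with parameters
    [a x]. *)
Definition mixture (R : realType) (n : nat) (M : finType) (w : M -> R)
    (a : M -> 'I_n -> R) : {ffun cube n -> R} :=
  [ffun c => \sum_(x : M) w x * product_mass (a x) c].

(** The conditions on weights and parameters under which the mixture is a
    pairwise independent law with marginals [p]. *)
Definition pairwise_mixture (R : realType) (n : nat) (M : finType)
    (p : 'I_n -> R) (w : M -> R) (a : M -> 'I_n -> R) : Prop :=
  [/\ (forall x, 0 <= w x) /\ \sum_x w x = 1,
      forall x i, 0 <= a x i <= 1,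
      forall i, \sum_x w x * a x i = p i &
      forall i j, i != j -> \sum_x w x * (a x i * a x j) = p i * p j].

Lemma sum_cube_prod (R : realType) (n : nat) (F : 'I_n -> bool -> R) :
  \sum_(c : cube n) \prod_(i < n) F i (c i) =
  \prod_(i < n) (F i true + F i false).
Proof.
rewrite -(bigA_distr_bigA (R := R) F).
by apply: eq_bigr => i _; rewrite big_bool.
Qed.

Lemma product_mass_ones (R : realType) (n : nat) (a : 'I_n -> R)
    (A : {set 'I_n}) :
  \sum_(c : cube n | [forall i in A, c i]) product_mass a c =
  \prod_(i in A) a i.
Proof.
pose F i b : R := if b then a i else if i \in A then 0 else 1 - a i.
rewrite big_mkcond /= [RHS]big_mkcond /=.
transitivity (\sum_(c : cube n) \prod_(i < n) F i (c i)).
  apply: eq_bigr => c _; case: ifPn => [/forall_inP Ac|].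
    apply: eq_bigr => i _; rewrite /F; case: ifPn => // ci.
    by case: ifPn => // /Ac; rewrite (negbTE ci).
  rewrite negb_forall_in => /exists_inP[i iA ci].
  by rewrite (bigD1 i) //= /F (negbTE ci) iA mul0r.
rewrite sum_cube_prod; apply: eq_bigr => i _; rewrite /F.
by case: ifP => _; ring.
Qed.

Lemma product_mass_zeros (R : realType) (n : nat) (a : 'I_n -> R) :
  \sum_(c : cube n | [forall i, ~~ c i]) product_mass a c =
  \prod_(i < n) (1 - a i).
Proof.
pose F i b : R := if b then 0 else 1 - a i.
rewrite big_mkcond /=.
transitivity (\sum_(c : cube n) \prod_(i < n) F i (c i)).
  apply: eq_bigr => c _; case: ifPn => [/forallP c0|].
    by apply: eq_bigr => i _; rewrite /F (negbTE (c0 i)).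
  rewrite negb_forall => /existsP[i]; rewrite negbK => ci.
  by rewrite (bigD1 i) //= /F ci mul0r.
by rewrite sum_cube_prod; apply: eq_bigr => i _; rewrite /F add0r.
Qed.

Lemma Prob_mixture (R : realType) (n : nat) (M : finType) (w : M -> R)
    (a : M -> 'I_n -> R) (P : pred (cube n)) :
  Prob (mixture w a) [pred c | P c] =
  \sum_x w x * \sum_(c : cube n | P c) product_mass (a x) c.
Proof.
rewrite /Prob; under eq_bigr do rewrite ffunE.
by rewrite exchange_big /=; apply: eq_bigr => x _; rewrite mulr_sumr.
Qed.

Lemma Prob_mixture_ones (R : realType) (n : nat) (M : finType) (w : M -> R)
    (a : M -> 'I_n -> R) (A : {set 'I_n}) (P : pred (cube n)) :
  (forall c : cube n, P c = [forall i in A, c i]) ->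
  Prob (mixture w a) [pred c | P c] = \sum_x w x * \prod_(i in A) a x i.
Proof.
move=> PA; rewrite Prob_mixture; apply: eq_bigr => x _.
by rewrite (eq_bigl _ _ PA) product_mass_ones.
Qed.

Lemma mixture_pairwise_indep (R : realType) (n : nat) (M : finType)
    (p : 'I_n -> R) (w : M -> R) (a : M -> 'I_n -> R) :
  pairwise_mixture p w a -> pairwise_indep_laws p (mixture w a).
Proof.
move=> [[w_ge0 w_sum] a01 a_marg a_pair]; split.
- split=> [c|].
    rewrite ffunE; apply: sumr_ge0 => x _; rewrite mulr_ge0 //.
    apply: prodr_ge0 => i _; case/andP: (a01 x i) => a_ge0 a_le1.
    by case: ifP; rewrite ?subr_ge0.
  transitivity (Prob (mixture w a) [pred c | predT c]); first exact: eq_bigl.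
  rewrite (@Prob_mixture_ones _ _ _ _ _ finset.set0) => [|c].
    by rewrite -[RHS]w_sum; apply: eq_bigr => x _; rewrite big_set0 mulr1.
  by apply/esym/forall_inP => i; rewrite inE.
- move=> i; rewrite (@Prob_mixture_ones _ _ _ _ _ [set i]) => [|c].
    by rewrite -a_marg; apply: eq_bigr => x _; rewrite big_set1.
  apply/idP/forall_inP => [ci k|]; first by rewrite inE => /eqP->.
  by apply; rewrite inE.
- move=> i j ij; have nij : i != j by rewrite -val_eqE /= ltn_eqF.
  rewrite (@Prob_mixture_ones _ _ _ _ _ [set i; j]) => [|c].
    rewrite -a_pair //; apply: eq_bigr => x _.
    by rewrite big_setU1 ?inE //= big_set1.
  apply/andP/forall_inP => [[ci cj] k|Ac].
    by rewrite !inE => /orP[] /eqP->.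
  by rewrite !Ac // !inE eqxx ?orbT.
Qed.

Lemma sum_cube_gt0 (n : nat) (c : cube n) :
  (1 <= \sum_(i < n) c i)%N = ~~ [forall i, ~~ c i].
Proof.
rewrite lt0n sum_nat_eq0; congr (~~ _).
by apply: eq_forallb => i; rewrite eqb0.
Qed.

Lemma Prob_mixture_union (R : realType) (n : nat) (M : finType)
    (p : 'I_n -> R) (w : M -> R) (a : M -> 'I_n -> R) :
  pairwise_mixture p w a ->
  Prob (mixture w a) [pred c : cube n | (1 <= \sum_(i < n) c i)%N] =
  1 - \sum_x w x * \prod_(i < n) (1 - a x i).
Proof.
move=> /mixture_pairwise_indep[[_ sum1] _ _].
have -> : \sum_x w x * \prod_(i < n) (1 - a x i) =
    Prob (mixture w a) [pred c : cube n | [forall i, ~~ c i]].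
  rewrite Prob_mixture; apply: eq_bigr => x _.
  by rewrite product_mass_zeros.
rewrite -sum1 /Prob [X in X - _](bigID (fun c : cube n => [forall i, ~~ c i])).
rewrite /= addrAC subrr add0r; apply: eq_bigl => c.
by rewrite inE sum_cube_gt0.
Qed.

(** * Disjunction with independent bits *)

(** The parameter of the disjunction of two independent bits of parameters
    [x] and [y]. *)
Definition or_param (R : realType) (x y : R) : R := x + (1 - x) * y.

Lemma or_mixtureP (R : realType) (n : nat) (M : finType)
    (r e : 'I_n -> R) (w : M -> R) (a : M -> 'I_n -> R) :
  (forall i, 0 <= e i <= 1) -> pairwise_mixture r w a ->
  pairwise_mixture (fun i => or_param (r i) (e i)) w
                   (fun x i => or_param (a x i) (e i)).
Proof.
move=> e01 [[w_ge0 w_sum] a01 a_marg a_pair]; split=> //.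
- move=> x i; case/andP: (a01 x i) => a_ge0 a_le1.
  case/andP: (e01 i) => e_ge0 e_le1.
  by rewrite /or_param; apply/andP; split; nra.
- move=> i; rewrite /or_param -a_marg.
  rewrite (eq_bigr (fun x => (w x * a x i) * (1 - e i) + w x * e i)) => [|x _].
    by rewrite big_split /= -!mulr_suml w_sum; ring.
  by ring.
- move=> i j nij; rewrite /or_param.
  rewrite (eq_bigr (fun x =>
      (w x * (a x i * a x j)) * ((1 - e i) * (1 - e j))
      + ((w x * a x i) * ((1 - e i) * e j)
      + ((w x * a x j) * ((1 - e j) * e i) + w x * (e i * e j))))) => [|x _].
    by rewrite !big_split /= -!mulr_suml w_sum !a_marg a_pair //; ring.
  by ring.
Qed.

Lemma or_mixture_zeros (R : realType) (n : nat) (M : finType)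
    (e : 'I_n -> R) (w : M -> R) (a : M -> 'I_n -> R) :
  \sum_x w x * \prod_(i < n) (1 - or_param (a x i) (e i)) =
  (\sum_x w x * \prod_(i < n) (1 - a x i)) * \prod_(i < n) (1 - e i).
Proof.
rewrite mulr_suml; apply: eq_bigr => x _; rewrite -mulrA -big_split /=.
by congr (_ * _); apply: eq_bigr => i _; rewrite /or_param; ring.
Qed.

(** * The extremal mixture *)

(** The weights of the extremal mixture, whose components are indexed by
    [option (option 'I_n)]: [Some (Some j)] is the point mass at the [j]-th
    unit vector, [Some None] the point mass at 0, and [None] the product law with parameters [p i / p m]. *)
Definition star_weight (R : realType) (n : nat) (p : 'I_n -> R) (m : 'I_n)
    (x : option (option 'I_n)) : R :=
  match x with
  | Some (Some j) => (1 - p m) * p j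
  | Some None => (1 - p m) * (1 - \sum_(i < n | i != m) p i)
  | None => p m ^+ 2
  end.

(** The parameters of its components, in the same order. *)
Definition star_param (R : realType) (n : nat) (p : 'I_n -> R) (m : 'I_n)
    (x : option (option 'I_n)) (i : 'I_n) : R :=
  match x with
  | Some (Some j) => (i == j)%:R
  | Some None => 0
  | None => p i / p m
  end.

Lemma big_option (R : realType) (T : finType) (F : option T -> R) :
  \sum_x F x = F None + \sum_(t : T) F (Some t).
Proof.
rewrite (bigD1 None) //=; congr (_ + _).
rewrite (reindex_omap Some id) /=; last by case.
by apply: eq_bigl => t; rewrite eqxx.
Qed.

Lemma sum_unit_vector (R : realType) (n : nat) (F : 'I_n -> R) (i : 'I_n) :
  \sum_(j < n) F j * (i == j)%:R = F i.
Proof.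
rewrite (bigD1 i) //= eqxx mulr1 big1 ?addr0 // => j.
by rewrite eq_sym => /negbTE->; rewrite mulr0.
Qed.

Lemma star_mixtureP (R : realType) (n : nat) (p : 'I_n -> R) (m : 'I_n) :
  (forall i, 0 <= p i <= 1) -> (forall i, p i <= p m) ->
  \sum_(i < n | i != m) p i <= 1 ->
  pairwise_mixture p (star_weight p m) (star_param p m).
Proof.
move=> p01 p_le S_le1.
have p_ge0 i : 0 <= p i by case/andP: (p01 i).
have pm_le1 : p m <= 1 by case/andP: (p01 m).
(* Since [p m] is the largest probability, this also holds when [p m = 0]. *)
have divmK i : p m * (p i / p m) = p i.
  have [pm0|pm_neq0] := eqVneq (p m) 0; last by rewrite mulrC divfK.
  by apply/eqP; rewrite pm0 mul0r eq_le p_ge0 -pm0 p_le.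
split.
- split=> [[[j|]|]|] /=.
  + by rewrite mulr_ge0 ?subr_ge0.
  + by rewrite mulr_ge0 ?subr_ge0.
  + exact: exprn_ge0.
  + rewrite !big_option /= -mulr_sumr [\sum_(j < n) p j](bigD1 m) //=; ring.
- move=> [[j|]|] i /=.
  + by case: eqP => _; rewrite !lexx ler01.
  + by rewrite lexx ler01.
  + rewrite divr_ge0 //=; have [pm0|pm_neq0] := eqVneq (p m) 0.
      by rewrite pm0 invr0 mulr0 ler01.
    by rewrite ler_pdivrMr ?mul1r // lt_neqAle eq_sym pm_neq0 p_ge0.
- move=> i; rewrite !big_option /= sum_unit_vector expr2 -mulrA divmK; ring.
- move=> i j nij; rewrite !big_option /= [X in _ + X]addrC big1 => [|k _].
    by rewrite -{2}(divmK i) -{2}(divmK j); ring.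
  case: (eqVneq i k) => [<-|]; last by rewrite mul0r mulr0.
  by rewrite eq_sym (negbTE nij) !mulr0.
Qed.

Lemma star_mixture_zeros (R : realType) (n : nat) (p : 'I_n -> R) (m : 'I_n) :
  \sum_x star_weight p m x * \prod_(i < n) (1 - star_param p m x i) =
  (1 - p m) * (1 - \sum_(i < n | i != m) p i).
Proof.
rewrite !big_option /= [X in _ + (_ + X)]big1 => [|j _]; last first.
  by rewrite (bigD1 j) //= eqxx subrr mul0r mulr0.
rewrite [X in _ + (_ * X + _)]big1 => [|i _]; last exact: subr0.
rewrite mulr1 addr0 (bigD1 m) //=.
have [->|pm_neq0] := eqVneq (p m) 0; first by rewrite expr0n mul0r add0r.
by rewrite divff // subrr mul0r mulr0 add0r.
Qed.

(** * Bounds on the union and their attainment *)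

Lemma Prob_indicator (R : realType) (n : nat) (theta : {ffun cube n -> R})
    (P : pred (cube n)) :
  Prob theta [pred c | P c] = \sum_c theta c * (P c)%:R.
Proof.
rewrite /Prob big_mkcond; apply: eq_bigr => c _.
by rewrite inE; case: (P c); rewrite ?mulr1 ?mulr0.
Qed.

Lemma Prob_union_le (R : realType) (n : nat) (p : 'I_n -> R) (m : 'I_n)
    (theta : {ffun cube n -> R}) :
  pairwise_indep_laws p theta ->
  Prob theta [pred c : cube n | (1 <= \sum_(i < n) c i)%N] <=
  \sum_(i < n) p i - p m * \sum_(i < n | i != m) p i.
Proof.
move=> [[th_ge0 _] th_marg th_pair].
have pairE i : i != m -> p m * p i = Prob theta [pred c : cube n | c i && c m].
  rewrite neq_ltn => /orP[im|mi]; first by rewrite th_pair // mulrC.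
  by rewrite -th_pair //; apply: eq_bigl => c; rewrite !inE andbC.
have -> : \sum_(i < n) p i = \sum_(c : cube n) \sum_(i < n) theta c * (c i)%:R.
  rewrite exchange_big; apply: eq_bigr => i _.
  by rewrite -th_marg Prob_indicator.
have -> : p m * \sum_(i < n | i != m) p i =
    \sum_(c : cube n) \sum_(i < n | i != m) theta c * (c i && c m)%:R.
  rewrite exchange_big mulr_sumr; apply: eq_bigr => i im.
  by rewrite pairE // Prob_indicator.
rewrite Prob_indicator.
rewrite -sumrB; apply: ler_sum => c _.
rewrite -!mulr_sumr -mulrBr; apply: ler_wpM2l => //.
rewrite [X in X - _](bigD1 m) //= sum_cube_gt0.
have [cm|cm] := boolP (c m).
  under [X in _ - X]eq_bigr do rewrite andbT.
  by rewrite addrK lern1 leq_b1.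
under [X in _ - X]eq_bigr do rewrite andbF.
rewrite [X in _ - X]big1 // subr0 add0r.
have [_|] := boolP [forall i, ~~ c i]; first exact: sumr_ge0.
rewrite negb_forall => /existsP[i]; rewrite negbK => ci.
have im : i != m by apply: contraNneq cm => <-.
by rewrite (bigD1 i) //= ci lerDl sumr_ge0.
Qed.

Lemma Prob_le1 (R : realType) (n : nat) (theta : {ffun cube n -> R})
    (A : {pred cube n}) :
  laws theta -> Prob theta A <= 1.
Proof.
move=> [th_ge0 <-]; rewrite /Prob [leRHS](bigID (mem A)) /=.
by rewrite lerDl sumr_ge0.
Qed.

Lemma union_attained_le1 (R : realType) (n : nat) (p : 'I_n -> R) (m : 'I_n) :
  (forall i, 0 <= p i <= 1) -> (forall i, p i <= p m) ->
  \sum_(i < n | i != m) p i <= 1 ->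
  tail_probs 1 p (\sum_(i < n) p i - p m * \sum_(i < n | i != m) p i).
Proof.
move=> p01 p_le S_le1.
have mixP := star_mixtureP p01 p_le S_le1.
exists (mixture (star_weight p m) (star_param p m)).
  exact: mixture_pairwise_indep.
rewrite (Prob_mixture_union mixP) star_mixture_zeros.
by rewrite [X in _ = X - _](bigD1 m) //=; ring.
Qed.

Lemma union_attained_gt1 (R : realType) (n : nat) (p : 'I_n -> R) (m : 'I_n) :
  (forall i, 0 <= p i <= 1) -> (forall i, p i <= p m) ->
  1 < \sum_(i < n | i != m) p i ->
  tail_probs 1 p 1.
Proof.
move=> p01 p_le; set S := \sum_(i < n | _) _ => S_gt1.
have S_gt0 : 0 < S by apply: lt_trans S_gt1.
pose r i := if i == m then p m else p i / S.
have r_m : r m = p m by rewrite /r eqxx.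
have r_ge0 i : 0 <= r i.
  rewrite /r; case: ifP => _; first by case/andP: (p01 m).
  by rewrite divr_ge0 ?(ltW S_gt0) //; case/andP: (p01 i).
have r_le i : r i <= p i.
  rewrite /r; case: eqP => [->//|_].
  by rewrite ler_pdivrMr // ler_peMr ?(ltW S_gt1) //; case/andP: (p01 i).
have p_le1 i : p i <= 1 by case/andP: (p01 i).
have r_sum : \sum_(i < n | i != m) r i = 1.
  under eq_bigr => i /negbTE im do rewrite /r im.
  by rewrite -mulr_suml divff // gt_eqF.
have r_mixP : pairwise_mixture r (star_weight r m) (star_param r m).
  apply: star_mixtureP => [i|i|]; last by rewrite r_sum.
    by rewrite r_ge0 (le_trans (r_le i)).
  by rewrite r_m (le_trans (r_le i)).
(* Solves [or_param (r i) (e i) = p i]; if [r i = 1] then [p i = 1] and the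
   quotient by zero is 0, which is a solution as well. *)
pose e i := (p i - r i) / (1 - r i).
have e01 i : 0 <= e i <= 1.
  have [r1|r_neq1] := eqVneq (1 - r i) 0.
    by rewrite /e r1 invr0 mulr0 lexx ler01.
  have r_lt1 : 0 < 1 - r i.
    by rewrite lt_neqAle eq_sym r_neq1 subr_ge0 (le_trans (r_le i)).
  rewrite /e divr_ge0 ?subr_ge0 ?(ltW r_lt1) //=; last by rewrite -subr_ge0 ltW.
  by rewrite ler_pdivrMr // mul1r lerB.
have or_re i : or_param (r i) (e i) = p i.
  rewrite /or_param /e; have [r1|r_neq1] := eqVneq (1 - r i) 0.
    by have := r_le i; have := p_le1 i; rewrite r1; lra.
  by rewrite mulrC divfK //; ring.
have [w_sum a01 a_marg a_pair] := or_mixtureP e01 r_mixP.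
have mixP : pairwise_mixture p (star_weight r m)
    (fun x i => or_param (star_param r m x i) (e i)).
  by split=> // [i|i j nij]; rewrite ?a_marg ?a_pair ?or_re.
exists (mixture (star_weight r m)
          (fun x i => or_param (star_param r m x i) (e i))).
  exact: mixture_pairwise_indep.
rewrite (Prob_mixture_union mixP) or_mixture_zeros star_mixture_zeros r_sum.
by rewrite subrr mulr0 mul0r subr0.
Qed.

Theorem theorem2p3 (R : realType) (n : nat) (hn : (2 <= n)%N) (p : 'I_n -> R)
    (hp01 : forall i : 'I_n, 0 <= p i <= 1)
    (hsorted : forall i j : 'I_n, (i <= j)%N -> p i <= p j) :
  is_Pbar 1 p
    (Num.min (\sum_(i < n) p i
              - p (last_ord hn) * (\sum_(i < n | (i < n.-1)%N) p i))
             1).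
Proof.
set m := last_ord hn.
have le_m (i : 'I_n) : (i <= m)%N by rewrite /= -ltnS prednK // (ltn_trans _ hn).
rewrite [X in _ * X](eq_bigl (fun i : 'I_n => i != m)) => [|i]; last first.
  by rewrite -val_eqE /=; case: ltngtP (le_m i).
have p_le i : p i <= p m by apply: hsorted.
split; last first.
  move=> _ [theta thP <-]; rewrite le_min Prob_union_le //=.
  by apply: Prob_le1; case: thP.
have [S_le1|S_gt1] := leP (\sum_(i < n | i != m) p i) 1.
  rewrite min_l; first exact: union_attained_le1.
  by rewrite (bigD1 m) //=; case/andP: (hp01 m) => pm_ge0 pm_le1; nra.
rewrite min_r; first exact: union_attained_gt1 S_gt1.
by rewrite (bigD1 m) //=; case/andP: (hp01 m) => pm_ge0 pm_le1; nra.
Qed.
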